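(* Let $S=\operatorname{conv}\{v_0,v_1,v_2\}\subseteq\mathbb{R}^2$ be a triangle with the origin in its interior and with rational vertex directions. Let $p_i\in\mathbb{Z}^2$ be the primitive lattice vector that is a positive multiple of $v_i$; let $\alpha=(\alpha_0,\alpha_1,\alpha_2)\in\mathbb{N}^3$ with $\sum_i\alpha_ip_i=\mathbf{0}$ and $\gcd(\alpha_0,\alpha_1,\alpha_2)=1$; let $\beta_i=\alpha_i\|p_i\|/\|v_i\|$; and let $\ell_i$ be the lattice length of the segment $S\cap\mathbb{R}v_i$ (its Euclidean length divided by $\|p_i\|$). Assume $(\alpha_0,\alpha_1,\alpha_2)\ne(1,1,1)$. Then for some $i\in\{0,1,2\}$, writing $\{j,k\}=\{0,1,2\}\setminus\{i\}$, \[\frac1{\ell_j}+\frac1{\ell_k}-\frac1{\ell_i}\ \ge\ \frac{2\beta_j\beta_k}{\alpha_j\alpha_k(\beta_j+\beta_k)}.\] Moreover, the inequality is strict unless, up to reordering the indices, $(\alpha_0,\alpha_1,\alpha_2)=(2,1,1)$ and $\beta_1=\beta_2$.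
   Context: $S$ has rational vertex directions if each line $\mathbb{R}v_i$ through the origin has rational direction. *)

(* Defs.v *)
From HB Require Import structures.
From mathcomp Require Import all_boot all_order all_fingroup all_algebra.
From mathcomp Require Import all_classical all_reals all_analysis.

Set Implicit Arguments.
Unset Strict Implicit.
Unset Printing Implicit Defensive.

Import Order.TTheory GRing.Theory Num.Theory.
Import numFieldNormedType.Exports.

Local Open Scope classical_set_scope.
Local Open Scope ring_scope.

Definition conv_hull (R : realType) (n : nat) (v : 'I_n -> 'rV[R]_2) :
    set 'rV[R]_2 :=
  [set x | exists w : 'I_n -> R,
    [/\ forall i, 0 <= w i, \sum_i w i = 1 & x = \sum_i w i *: v i]].

Definition affinely_independent (R : realType) (n : nat)
    (v : 'I_n -> 'rV[R]_2) : Prop :=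
  forall c : 'I_n -> R,
    \sum_i c i = 0 -> \sum_i c i *: v i = 0 -> forall i, c i = 0.

(* The library norm on row vectors is the sup norm, hence this definition;
   both norms induce the same topology. *)
Definition enorm (R : realType) (x : 'rV[R]_2) : R :=
  Num.sqrt (\sum_i x 0 i ^+ 2).

Definition span_line (R : realType) (v : 'rV[R]_2) : set 'rV[R]_2 :=
  range (fun t : R => t *: v).

Definition segment (R : realType) (a b : 'rV[R]_2) : set 'rV[R]_2 :=
  [set (1 - t) *: a + t *: b | t in `[0, 1]].

Definition rational_direction (R : realType) (L : set 'rV[R]_2) : Prop :=
  exists q : 'rV[rat]_2, q != 0 /\ L = span_line (map_mx ratr q).

Definition lattice_point (R : realType) (p : 'rV[int]_2) : 'rV[R]_2 :=
  map_mx intr p.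

Definition primitive (p : 'rV[int]_2) : Prop := gcdz (p 0 0) (p 0 1) = 1.

(* The length of A is measured relative to p, which is meant to be the
   primitive lattice vector parallel to A. *)
Definition is_lattice_length (R : realType) (p : 'rV[int]_2)
    (A : set 'rV[R]_2) (l : R) : Prop :=
  exists a b : 'rV[R]_2,
    A = segment a b /\ l = enorm (b - a) / enorm (lattice_point R p).

(* Main.v *)
Require Import Defs.
From HB Require Import structures.
From mathcomp Require Import all_boot all_order all_fingroup all_algebra.
From mathcomp Require Import all_classical all_reals all_analysis.
From mathcomp Require Import ring lra zify.

(* Since p_i = c_i v_i with c_i = beta_i / alpha_i, the relation on the p_i
   says that g_i = beta_i / sum_j beta_j are the barycentric coordinates of the
   origin.  The line R v_i meets S in the segment from v_i to
   -(g_i / (1 - g_i)) v_i, whence 1 / ell_i = (beta_i / alpha_i) (1 - g_i).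

   Primitivity of the p_i makes the alpha_i pairwise coprime, so if they are not
   all 1 then alpha has a strict maximum; i is taken to be its index.  With
   a = alpha_i > b, c, the difference of the two sides is, up to a positive
   factor, a combination with nonnegative coefficients of b + c - 2 and of the
   quadratic form
     G = (c y + b z)(y + z) - (b c / a)(y + z)^2 - 2 y z
   in y = beta_j, z = beta_k.  As a >= max(b, c) + 1, G >= 0, with equality only
   for (a, b, c) = (2, 1, 1), where G = (y - z)^2 / 2. *)

Set Implicit Arguments.
Unset Strict Implicit.
Unset Printing Implicit Defensive.

Import Order.TTheory GRing.Theory Num.Theory.
Import numFieldNormedType.Exports.

Local Open Scope classical_set_scope.
Local Open Scope ring_scope.

(** * The quadratic inequality in the weights *)

Lemma weighted_form_ge0 (R : realFieldType) (a b c : nat) (y z : R) :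
  (b < a)%N -> (c < a)%N -> (0 < b)%N -> (0 < c)%N -> 0 < y -> 0 < z ->
  let G := (c%:R * y + b%:R * z) * (y + z)
           - b%:R * c%:R / a%:R * (y + z) ^+ 2 - 2 * y * z in
  0 <= G /\ (G = 0 -> [/\ a = 2, b = 1, c = 1 & y = z]%N).
Proof.
move=> + + + + + + G; rewrite {}/G.
wlog cb : b c y z / (c <= b)%N => [hw ba ca b0 c0 y0 z0|ba ca b0 c0 y0 z0].
  have [/hw|/ltnW/hw] := leqP c b; first exact.
  move=> /(_ z y ca ba c0 b0 z0 y0) [ge0 eq0].
  rewrite (_ : (_ * y + _) * _ - _ - _ =
    (b%:R * z + c%:R * y) * (z + y) - c%:R * b%:R / a%:R * (z + y) ^+ 2
     - 2 * z * y); last by ring.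
  by split=> // /eq0 [-> -> -> ->].
set G := (X in 0 <= X).
have a_gt0 : 0 < a%:R :> R by rewrite ltr0n; lia.
have c_ge1 : 1 <= c%:R :> R by rewrite ler1n.
(* The bound on [G] below replaces [a] by its least possible value [b + 1]: there [b c / a] equals
   [c - q]. *)
set q : R := c%:R / b.+1%:R.
have b1_gt0 : 0 < b.+1%:R :> R by [].
have bca : b%:R * c%:R / a%:R <= c%:R - q :> R.
  have -> : c%:R - q = b%:R * c%:R / b.+1%:R.
    by rewrite /q; field; rewrite nat1r gt_eqF.
  by rewrite ler_pM2l ?mulr_gt0 ?ltr0n// lef_pV2 ?posrE// ler_nat.
(* With [c y + b z = c (y + z) + (b - c) z], the lower bound depends only on [q] and the gap
   [b - c]; the cases are gap 0, 1 and at least 2, and equality can occur only for gap 0. *)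
have GE : (b%:R - c%:R) * z * (y + z) + q * (y + z) ^+ 2 - 2 * y * z <= G.
  have -> : G = (b%:R - c%:R) * z * (y + z)
      + (c%:R - b%:R * c%:R / a%:R) * (y + z) ^+ 2 - 2 * y * z.
    by rewrite /G; ring.
  rewrite lerD2r lerD2l ler_pM2r ?exprn_gt0 ?addr_gt0//.
  by rewrite lerBrDl -lerBrDr.
have [d bE] : exists d, b = (c + d)%N by exists (b - c)%N; lia.
case: d bE => [|d] bE.
  have q12 : 2^-1 <= q.
    rewrite /q bE addn0 ler_pdivlMr// -[c.+1%:R]natr1; lra.
  have {}GE : q * (y + z) ^+ 2 - 2 * y * z <= G.
    by move: GE; rewrite bE addn0 subrr !mul0r add0r.
  have qyz : 2^-1 * (y + z) ^+ 2 <= q * (y + z) ^+ 2.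
    by rewrite ler_wpM2r// sqr_ge0.
  have sq : 2^-1 * (y + z) ^+ 2 - 2 * y * z = 2^-1 * (y - z) ^+ 2 by field.
  have sq0 := sqr_ge0 (y - z).
  split; first by lra.
  rewrite -/G => G0.
  have yz : y = z.
    by apply/eqP; rewrite -subr_eq0 -sqrf_eq0; apply/eqP; lra.
  have := G0; rewrite /G bE addn0 yz => /eqP.
  rewrite (_ : _ - _ - _ =
    2 * z ^+ 2 * (2 * c%:R - 2 * (c%:R * c%:R / a%:R) - 1)); last by ring.
  rewrite !mulf_eq0 pnatr_eq0/= (gt_eqF z0)/= => /eqP eq0.
  (* Clearing the denominator gives an equation in naturals. With [c = m + 1] and [a = c + e + 1] it
     reads [2 m e + m + e = 0]. *)
  have : (2 * c * a)%:R = (2 * c * c + a)%:R :> R.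
    rewrite natrD !natrM; apply/eqP; rewrite -subr_eq0; apply/eqP.
    rewrite -[RHS](mulr0 a%:R) -eq0; field; rewrite gt_eqF//.
  move=> /eqP; rewrite eqr_nat => /eqP.
  have [e aE] : exists e, a = (c + e.+1)%N by exists (a - c.+1)%N; clear -ca; lia.
  rewrite {}aE -{}[c]prednK// in bE *; move: c.-1 bE => m bE eqm.
  have [m0 e0] : m = 0 /\ e = 0 by clear -eqm; nia.
  by subst.
suff G0 : 0 < G by split; [exact: ltW|rewrite -/G => G_eq0; rewrite G_eq0 ltxx in G0].
apply: lt_le_trans GE.
have q_gt0 : 0 < q by rewrite divr_gt0//; lra.
have yz0 : 0 < y * z by rewrite mulr_gt0.
have z20 : 0 < z ^+ 2 by rewrite exprn_gt0.
have s20 : 0 < q * (y + z) ^+ 2 by rewrite mulr_gt0 ?exprn_gt0 ?addr_gt0.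
rewrite bE natrD [c%:R + _]addrC addrK.
(* For gap 1, [q >= 1/3] bounds the form below by [(y - 2z)^2 / 3 + y z]. For a larger gap,
   [2 z (y + z)] already exceeds [2 y z]. *)
case: d bE => [|d] bE.
  have q13 : 3^-1 <= q.
    rewrite /q bE addn1 ler_pdivlMr// -[c.+2%:R]natr1 -[c.+1%:R]natr1; lra.
  have : 3^-1 * (y + z) ^+ 2 <= q * (y + z) ^+ 2.
    by rewrite ler_wpM2r// sqr_ge0.
  have := sqr_ge0 (y - z *+ 2).
  have := sqr_ge0 (y - z).
  nra.
have : 0 <= d%:R * (z * (y + z)) by rewrite !mulr_ge0 ?addr_ge0 // ltW.
rewrite -[d.+2]addn2 natrD; nra.
Qed.

(** With [x, y, z] the values of [beta] at [i, j, k], the three terms of [lhs] are the reciprocals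
    of the lattice lengths. Strictness comes from [G] alone; the term in [b + c - 2] is only used as
    nonnegative. *)
Lemma weighted_sum_ge (R : realFieldType) (a b c : nat) (x y z : R) :
  (b < a)%N -> (c < a)%N -> (0 < b)%N -> (0 < c)%N ->
  0 < x -> 0 < y -> 0 < z ->
  let B := x + y + z in
  let lhs := y / b%:R * (1 - y / B) + z / c%:R * (1 - z / B)
             - x / a%:R * (1 - x / B) in
  let rhs := 2 * y * z / (b%:R * c%:R * (y + z)) in
  rhs <= lhs /\ (~ [/\ a = 2, b = 1, c = 1 & y = z]%N -> rhs < lhs).
Proof.
move=> ba ca b0 c0 x0 y0 z0 B lhs rhs.
have [G0 Geq] := weighted_form_ge0 ba ca b0 c0 y0 z0.
set G := (X in 0 <= X) in G0 Geq.
have [a' b' c'] : [/\ 0 < a%:R :> R, 0 < b%:R :> R & 0 < c%:R :> R].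
  by split; rewrite ltr0n//; lia.
have s0 : 0 < y + z by rewrite addr_gt0.
have B0 : 0 < B by rewrite !addr_gt0.
have K0 : 0 < x / (b%:R * c%:R * (y + z)) by rewrite divr_gt0// !mulr_gt0.
have diffE : lhs - rhs = (x / (b%:R * c%:R * (y + z)) * G
    + y * z * ((b + c)%:R - 2) / (b%:R * c%:R)) / B.
  rewrite /lhs /rhs /G /B; field.
  by rewrite !gt_eqF.
have r0 : 0 <= y * z * ((b + c)%:R - 2) / (b%:R * c%:R).
  have bc2 : 0 <= (b + c)%:R - 2 :> R by rewrite subr_ge0 ler_nat; exact: leq_add b0 c0.
  by rewrite divr_ge0// !mulr_ge0// ltW.
split=> [|neq].
  by rewrite -subr_ge0 diffE divr_ge0 ?addr_ge0 ?(mulr_ge0 (ltW K0))// ltW.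
rewrite -subr_gt0 diffE divr_gt0// ltr_wpDr// mulr_gt0//.
by rewrite lt_neqAle G0 andbT eq_sym; apply/eqP; rewrite /G => /Geq.
Qed.

(** * Euclidean norm, primitive vectors and lengths on a line *)

Lemma enormZ (R : realType) (c : R) (x : 'rV[R]_2) :
  enorm (c *: x) = `|c| * enorm x.
Proof.
rewrite /enorm (eq_bigr (fun i => c ^+ 2 * x 0 i ^+ 2)); last first.
  by move=> i _; rewrite mxE exprMn.
by rewrite -mulr_sumr sqrtrM ?sqr_ge0// sqrtr_sqr.
Qed.

Lemma enorm_gt0 (R : realType) (x : 'rV[R]_2) : x != 0 -> 0 < enorm x.
Proof.
move=> x0; rewrite sqrtr_gt0 lt_neqAle sumr_ge0 ?andbT; last first.
  by move=> i _; exact: sqr_ge0.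
apply: contra x0 => /eqP/esym/psumr_eq0P sum0; apply/eqP/rowP => i.
rewrite mxE; apply/eqP; rewrite -sqrf_eq0; apply/eqP.
by apply: sum0 => // j _; exact: sqr_ge0.
Qed.

Lemma primitive_neq0 (p : 'rV[int]_2) : primitive p -> p != 0.
Proof. by move=> pp; apply/eqP => p0; move: pp; rewrite p0 /primitive !mxE. Qed.

Lemma lattice_point_neq0 (R : realType) (p : 'rV[int]_2) :
  p != 0 -> lattice_point R p != 0.
Proof.
apply: contra => /eqP/rowP p0; apply/eqP/rowP => i; have := p0 i.
by rewrite !mxE => /eqP; rewrite intr_eq0 => /eqP.
Qed.

(** For primitive [p], the gcd of the coordinates of [p *+ k] is [k]. *)
Lemma primitive_dvd_coef (p : 'rV[int]_2) (d k : nat) :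
  primitive p -> (forall i, (d%:Z %| (p *+ k)%R 0%R i)%Z) -> (d %| k)%N.
Proof.
move=> pp dp.
suff : (d%:Z %| gcdz (p 0 0 *+ k)%R (p 0 1 *+ k)%R)%Z.
  rewrite -[p 0 0 *+ k]mulr_natr -[p 0 1 *+ k]mulr_natr -mulz_gcdl.
  by rewrite pp mul1r natz /dvdz !absz_nat.
have mulrnE i : (p *+ k) 0 i = p 0 i *+ k by rewrite mulmxnE.
by rewrite dvdz_gcd -!mulrnE !dp.
Qed.

(** The endpoints [a], [b] come in unknown order. Their coefficients lie in [[m, M]], so they differ
    by at most [M - m]; conversely [m] and [M] are convex combinations of them, so [M - m] is at
    most their distance. *)
Lemma segment_of_line_length (R : realType) (u a b : 'rV[R]_2)
    (A : set 'rV[R]_2) (m M : R) : m <= M -> u != 0 ->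
  A `<=` span_line u -> A (m *: u) -> A (M *: u) ->
  (forall r, A (r *: u) -> m <= r <= M) -> A = segment a b ->
  enorm (b - a) = (M - m) * enorm u.
Proof.
move=> mM u0 Au Am AM bnd AE.
have Aa : A a.
  rewrite AE; exists 0 => /=; first by rewrite in_itv/= lexx ler01.
  by rewrite subr0 scale1r scale0r addr0.
have Ab : A b.
  rewrite AE; exists 1 => /=; first by rewrite in_itv/= lexx ler01.
  by rewrite subrr scale1r scale0r add0r.
have [ra _ raE] := Au _ Aa; have [rb _ rbE] := Au _ Ab.
have := bnd ra; rewrite raE => /(_ Aa) bra.
have := bnd rb; rewrite rbE => /(_ Ab) brb.
have uinj s t : s *: u = t *: u -> s = t.
  move=> /eqP; rewrite -subr_eq0 -scalerBl scaler_eq0 (negPf u0) orbF.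
  by rewrite subr_eq0 => /eqP.
move: Am AM; rewrite AE -raE -rbE => -[s /= + sE] [t /= + tE].
rewrite !in_itv/= => s01 t01.
move: sE tE; rewrite !scalerA -!scalerDl => /uinj sE /uinj tE.
rewrite -scalerBl enormZ; congr (_ * _).
apply/eqP; rewrite eq_le; apply/andP; split; first by rewrite ler_norml; lra.
have -> : M - m = (t - s) * (rb - ra) by rewrite -sE -tE; ring.
rewrite (le_trans (ler_norm _))// normrM ler_piMl// ler_norml; lra.
Qed.

(** * Barycentric coordinates relative to the vertices, with [g] those of the origin *)

Section Barycentric.
Variables (R : realType) (n : nat) (v : 'I_n -> 'rV[R]_2) (g : 'I_n -> R).
Hypothesis v_free : affinely_independent v.
Hypothesis g_sum1 : \sum_i g i = 1.
Hypothesis g_sum0 : \sum_i g i *: v i = 0.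

Lemma sum_update (w : 'I_n -> R) (i : 'I_n) (r : R) :
  \sum_j (w j + (j == i)%:R * r) = \sum_j w j + r.
Proof.
rewrite big_split/=; congr (_ + _).
rewrite (bigD1 i)//= eqxx mul1r big1 ?addr0// => j /negPf ->.
by rewrite mul0r.
Qed.

Lemma sum_update_scale (w : 'I_n -> R) (i : 'I_n) (r : R) :
  \sum_j (w j + (j == i)%:R * r) *: v j = \sum_j w j *: v j + r *: v i.
Proof.
rewrite (eq_bigr _ (fun j _ => scalerDl _ _ _)) big_split/=; congr (_ + _).
rewrite (bigD1 i)//= eqxx mul1r big1 ?addr0// => j /negPf ->.
by rewrite mul0r scale0r.
Qed.

(** Coordinates are unique, and [r *: v i] is the affine combination of the origin and [v i] with
    weights [1 - r] and [r]. *)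
Lemma barycentric_on_axis (w : 'I_n -> R) (i j : 'I_n) (r : R) :
  \sum_k w k = 1 -> r *: v i = \sum_k w k *: v k ->
  w j = (1 - r) * g j + (j == i)%:R * r.
Proof.
move=> w1 wE.
pose c k := w k - (1 - r) * g k + (k == i)%:R * - r.
suff /(_ j) : forall k, c k = 0 by rewrite /c; lra.
apply: v_free.
  by rewrite sum_update sumrB w1 -mulr_sumr g_sum1; ring.
rewrite sum_update_scale (eq_bigr _ (fun j _ => scalerBl _ _ _)) sumrB -wE.
rewrite (eq_bigr (fun k => (1 - r) *: (g k *: v k))); last first.
  by move=> k _; rewrite scalerA.
by rewrite -scaler_sumr g_sum0 scaler0 subr0 scaleNr subrr.
Qed.

(** For small [e > 0] the point [- e *: v i] is still in the hull, and its [i]-th coordinate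
    [(1 + e) g i - e] is nonnegative. *)
Lemma barycentric_interior_gt0 i : interior (conv_hull v) 0 -> 0 < g i.
Proof.
move=> v0.
have : \forall e \near (0 : R)^'+, conv_hull v (- e *: v i).
  apply: cvg_within.
  have : (fun e : R => - e *: v i) @ (0 : R) --> (0 : 'rV[R]_2).
    rewrite -[X in _ --> X](scale0r (v i)) -[X in X *: _]oppr0.
    by apply: cvgZr_tmp; apply: cvgN; exact: cvg_id.
  exact.
move=> hull_near.
have [e /= [e0 [w [w0 w1 wE]]]] :=
  filter_ex (filterI (nbhs_right_gt (0 : R)) hull_near).
have := w0 i; rewrite (barycentric_on_axis i w1 wE) eqxx mul1r opprK => h.
by rewrite -(pmulr_rgt0 _ (_ : 0 < 1 + e)); lra.
Qed.

Hypothesis g_gt0 : forall i, 0 < g i.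

Lemma hull_axis_length (i : 'I_n) (a b : 'rV[R]_2) : g i < 1 -> v i != 0 ->
  conv_hull v `&` span_line (v i) = segment a b ->
  enorm (b - a) = enorm (v i) / (1 - g i).
Proof.
move=> gi1 vi0 AE.
have gi0 := g_gt0 i.
have d0 : 0 < 1 - g i by lra.
rewrite (@segment_of_line_length _ (v i) a b _ (- (g i / (1 - g i))) 1 _ vi0
  _ _ _ _ AE).
- by field; rewrite gt_eqF.
- by rewrite (le_trans (_ : _ <= 0))// oppr_le0 divr_ge0// ltW.
- by move=> x [].
- split; last by exists (- (g i / (1 - g i))).
  (* The line leaves the hull opposite [v i], where the [i]-th coordinate vanishes: drop [g i] and
     rescale the other coordinates to sum 1. *)
  exists (fun j => g j / (1 - g i) + (j == i)%:R * - (g i / (1 - g i))); split.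
  + move=> j; case: eqVneq => [->|_]; first by rewrite mul1r subrr.
    by rewrite mul0r addr0 divr_ge0 ?ltW.
  + rewrite sum_update -mulr_suml g_sum1; field; by rewrite gt_eqF.
  + rewrite sum_update_scale.
    rewrite (eq_bigr (fun j => (1 - g i)^-1 *: (g j *: v j))); last first.
      by move=> j _; rewrite scalerA mulrC.
    by rewrite -scaler_sumr g_sum0 scaler0 add0r.
- split; last by exists 1.
  exists (fun j => 0 + (j == i)%:R * 1); split.
  + by move=> j; rewrite add0r mulr1 ler0n.
  + by rewrite sum_update big1 ?add0r.
  + by rewrite sum_update_scale big1 ?add0r// => j _; rewrite scale0r.
- move=> r [[w [w0 w1 wE]] _].
  have wi := barycentric_on_axis i w1 wE; rewrite eqxx mul1r in wi.
  have wi0 := w0 i.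
  have wi1 : w i <= 1.
    by rewrite -w1 (bigD1 i)//= lerDl sumr_ge0.
  (* Here [w i = (1 - r) g i + r]; [w i <= 1] gives the upper bound on [r], [w i >= 0] the lower
     one. *)
  apply/andP; split; last by nra.
  by rewrite lerNl ler_pdivlMr//; lra.
Qed.

End Barycentric.

(** * Three indices and coincidences among the [alpha i] *)

Lemma big_ord3_distinct (V : nmodType) (F : 'I_3 -> V) (i j k : 'I_3) :
  i != j -> i != k -> j != k -> \sum_l F l = F i + F j + F k.
Proof.
move=> ij ik jk.
rewrite (bigD1 i)//= (bigD1 j) 1?eq_sym//= (bigD1 k)/=; last first.
  by rewrite eq_sym ik eq_sym jk.
rewrite big_pred0 ?addr0 ?addrA// => l.
apply/negbTE; move: ij ik jk; rewrite -!val_eqE /=.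
have := ltn_ord i; have := ltn_ord j; have := ltn_ord k; have := ltn_ord l.
lia.
Qed.

Lemma perm3_of_distinct (i j k : 'I_3) : i != j -> i != k -> j != k ->
  exists s : {perm 'I_3}, [/\ s 0 = i, s 1 = j & s 2 = k].
Proof.
move=> ij ik jk.
pose f (l : 'I_3) := if l == 0 then i else if l == 1 then j else k.
have f_inj : injective f.
  move=> a b; rewrite /f.
  case: a b => [[|[|[|//]]] ?] [[|[|[|//]]] ?] //= h; apply/val_inj => //=;
    by move: ij ik jk; rewrite h ?eqxx.
by exists (perm f_inj); rewrite !permE.
Qed.

(** For the third index [l], the relation reads [alpha l * p l = - alpha i * (p i + p j)];
    primitivity of [p l] makes [alpha i] divide [alpha l], hence the gcd of all weights. *)
Lemma equal_weights_eq1 (p : 'I_3 -> 'rV[int]_2) (alpha : 'I_3 -> nat)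
    (i j : 'I_3) :
  (forall l, primitive (p l)) -> \sum_l p l *+ alpha l = 0 ->
  (\big[gcdn/0]_l alpha l = 1)%N ->
  i != j -> alpha i = alpha j -> alpha i = 1%N.
Proof.
move=> pp rel gcd1 ij aij.
apply/eqP; rewrite -dvdn1 -gcd1; apply/dvdn_biggcdP => l _.
have [<-|il] := eqVneq i l; first exact: dvdnn.
have [<-|jl] := eqVneq j l; first by rewrite aij.
apply: (primitive_dvd_coef (pp l)) => m.
move: rel; rewrite (big_ord3_distinct _ ij il jl)/= -aij -mulrnDl.
move=> /(canRL (addKr _)); rewrite addr0 => ->.
rewrite !mxE mulmxnE -mulr_natr natz rpredN; exact: dvdz_mull.
Qed.

Theorem theorem4p9 (R : realType) (v : 'I_3 -> 'rV[R]_2)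
  (p : 'I_3 -> 'rV[int]_2) (alpha : 'I_3 -> nat) (beta ell : 'I_3 -> R)
  (v_triangle : affinely_independent v)
  (origin_interior : interior (conv_hull v) 0)
  (v_rational : forall i, rational_direction (span_line (v i)))
  (p_primitive : forall i, primitive (p i))
  (p_pos_multiple : forall i,
    exists c : R, 0 < c /\ lattice_point R (p i) = c *: v i)
  (alpha_relation : \sum_i p i *+ alpha i = 0)
  (alpha_gcd : (\big[gcdn/0]_i alpha i = 1)%N)
  (beta_def : forall i, beta i =
    (alpha i)%:R * enorm (lattice_point R (p i)) / enorm (v i))
  (ell_def : forall i,
    is_lattice_length (p i) (conv_hull v `&` span_line (v i)) (ell i))
  (alpha_neq111 : ~ (forall i, alpha i = 1%N)) :
  exists i : 'I_3, forall j k : 'I_3, j != i -> k != i -> j != k ->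
    let lhs := (ell j)^-1 + (ell k)^-1 - (ell i)^-1 in
    let rhs := 2 * beta j * beta k /
      ((alpha j)%:R * (alpha k)%:R * (beta j + beta k)) in
    lhs >= rhs /\
    (~ (exists s : {perm 'I_3},
          [/\ alpha (s 0) = 2%N, alpha (s 1) = 1%N, alpha (s 2) = 1%N
            & beta (s 1) = beta (s 2)]) ->
     lhs > rhs).
Proof.
have /choice[c cP] := p_pos_multiple.
have c_gt0 i : 0 < c i by have [] := cP i.
have pE i : lattice_point R (p i) = c i *: v i by have [] := cP i.
have v_neq0 i : v i != 0.
  have := lattice_point_neq0 R (primitive_neq0 (p_primitive i)).
  by rewrite pE scaler_eq0 negb_or => /andP[].
have vn_gt0 i : 0 < enorm (v i) by exact: enorm_gt0.
have pnE i : enorm (lattice_point R (p i)) = c i * enorm (v i).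
  by rewrite pE enormZ gtr0_norm.
have betaE i : beta i = (alpha i)%:R * c i.
  by rewrite beta_def pnE mulrA mulfK// gt_eqF.
have beta_ge0 i : 0 <= beta i by rewrite betaE mulr_ge0// ltW.
have beta_sum0 : \sum_i beta i *: v i = 0.
  have := congr1 (@lattice_point R) alpha_relation.
  rewrite /lattice_point map_mx0 raddf_sum/= => sum0; rewrite -[RHS]sum0.
  apply: eq_bigr => i _; rewrite raddfMn/= -/(lattice_point R (p i)) pE.
  by rewrite betaE -scalerA scaler_nat.
pose B := \sum_i beta i.
(* The [alpha i] are so far only naturals; if [B] vanished they would all be 0 and their gcd would
   be 0. Their positivity follows below from the origin being interior. *)
have B_gt0 : 0 < B.
  rewrite lt_neqAle sumr_ge0// andbT; apply/eqP => /esym/psumr_eq0P B0.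
  have alpha0 i : alpha i = 0%N.
    apply/eqP; have := B0 (fun i _ => beta_ge0 i) i isT; rewrite betaE => /eqP.
    by rewrite mulf_eq0 (gt_eqF (c_gt0 i)) orbF pnatr_eq0.
  by move: alpha_gcd; rewrite big1.
pose g i := beta i / B.
have g_sum1 : \sum_i g i = 1 by rewrite -mulr_suml mulfV// gt_eqF.
have g_sum0 : \sum_i g i *: v i = 0.
  rewrite (eq_bigr (fun i => B^-1 *: (beta i *: v i))).
    by rewrite -scaler_sumr beta_sum0 scaler0.
  by move=> i _; rewrite scalerA mulrC.
have g_gt0 i : 0 < g i.
  exact: (barycentric_interior_gt0 v_triangle g_sum1 g_sum0).
have beta_gt0 i : 0 < beta i.
  by have := g_gt0 i; rewrite /g pmulr_lgt0 ?invr_gt0.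
have alpha_gt0 i : (0 < alpha i)%N.
  by have := beta_gt0 i; rewrite betaE pmulr_lgt0// ltr0n.
have ellV i : g i < 1 -> (ell i)^-1 = beta i / (alpha i)%:R * (1 - g i).
  move=> gi1; have [a [b [abE ->]]] := ell_def i.
  rewrite (hull_axis_length v_triangle g_sum1 g_sum0 g_gt0 gi1 (v_neq0 i) abE).
  rewrite pnE betaE; field.
  by rewrite !gt_eqF ?subr_gt0 ?ltr0n ?vn_gt0 ?c_gt0 ?alpha_gt0.
pose i := [arg max_(i > (@ord0 2)) alpha i]%N.
have alpha_max j : (alpha j <= alpha i)%N.
  by rewrite /i; case: arg_maxnP => // m _; exact.
(* A tie at the maximum would force the maximum to be 1, hence all positive weights to be 1. *)
have alpha_lt j : j != i -> (alpha j < alpha i)%N.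
  move=> ji; rewrite ltn_neqAle alpha_max andbT; apply/eqP => aji.
  have ai1 : alpha i = 1%N.
    rewrite -aji.
    exact: (equal_weights_eq1 p_primitive alpha_relation alpha_gcd ji aji).
  apply: alpha_neq111 => l; apply/eqP; rewrite eqn_leq alpha_gt0 andbT.
  by rewrite -ai1.
exists i => j k ji ki jk.
have ij : i != j by rewrite eq_sym.
have ik : i != k by rewrite eq_sym.
have BE : B = beta i + beta j + beta k by exact: big_ord3_distinct.
have g_lt1 l : g l < 1.
  have [m ml] : exists m, m != l.
    by have [<-|] := eqVneq i l; [exists j|exists i].
  rewrite -g_sum1 (bigD1 l)//= ltrDl (bigD1 m)//= ltr_pwDl//.
  by rewrite sumr_ge0// => ? _; exact: ltW.
have [] := weighted_sum_ge (alpha_lt _ ji) (alpha_lt _ ki)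
  (alpha_gt0 j) (alpha_gt0 k) (beta_gt0 i) (beta_gt0 j) (beta_gt0 k).
rewrite -BE -/(g i) -/(g j) -/(g k) -!ellV// => ge gt.
(* In the equality case the permutation sending [0, 1, 2] to [i, j, k] is the excluded
   reordering. *)
split=> // nexc; apply: gt => -[ai aj ak bjk]; apply: nexc.
have [s [s0 s1 s2]] := perm3_of_distinct ij ik jk.
by exists s; rewrite s0 s1 s2.
Qed.
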